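(* Let $(E,\langle\cdot,\cdot\rangle,\Theta)$ be a pre-Courant algebroid and let $\mathcal{I}:E\to E$ be an endomorphism such that $\mathcal{I}^2=\lambda\,\mathrm{id}_E$ for some $\lambda\in\mathbb{R}\setminus\{0\}$. Then $$\mathsf{T}_{\Theta}\mathcal{I}=0\iff \mathsf{T}_{\Theta_{\mathcal{I}}}\mathcal{I}=0 .$$
   Context: Let $E\to M$ be a real vector bundle over a smooth manifold with a fibrewise non-degenerate symmetric bilinear form $\langle\cdot,\cdot\rangle$. A pre-Courant structure $\Theta$ on $(E,\langle\cdot,\cdot\rangle)$ is a pair $(\rho,[\cdot,\cdot])$, where $\rho:E\to TM$ is a vector bundle morphism (anchor) and $[\cdot,\cdot]:\Gamma(E)\times\Gamma(E)\to\Gamma(E)$ is an $\mathbb{R}$-bilinear (not necessarily skew-symmetric) bracket with $\rho(X)\cdot\langle Y,Z\rangle=\langle[X,Y],Z\rangle+\langle Y,[X,Z]\rangle$ and $\rho(X)\cdot\langle Y,Z\rangle=\langle X,[Y,Z]+[Z,Y]\rangle$ for all $X,Y,Z\in\Gamma(E)$; then $(E,\langle\cdot,\cdot\rangle,\Theta)$ is a pre-Courant algebroid. An endomorphism of $E$ is a vector bundle morphism $E\to E$ over $\mathrm{id}_M$. For an endomorphism $\mathcal{I}$, the deformed structure is $\Theta_{\mathcal{I}}=(\rho\circ\mathcal{I},[\cdot,\cdot]_{\mathcal{I}})$ with $[X,Y]_{\mathcal{I}}=[\mathcal{I}X,Y]+[X,\mathcal{I}Y]-\mathcal{I}[X,Y]$.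 The Nijenhuis torsion of an endomorphism $\mathcal{J}$ with respect to $\Theta=(\rho,[\cdot,\cdot])$ is $\mathsf{T}_{\Theta}\mathcal{J}(X,Y)=[\mathcal{J}X,\mathcal{J}Y]-\mathcal{J}\big([X,Y]_{\mathcal{J}}\big)$, $X,Y\in\Gamma(E)$. $\mathsf{T}_{\Theta_{\mathcal{I}}}\mathcal{J}$ is given by the same formula with the bracket $[\cdot,\cdot]$ replaced everywhere by $[\cdot,\cdot]_{\mathcal{I}}$. *)

(* Defs.v *)
From HB Require Import structures.
From mathcomp Require Import all_boot order ssralg ssrnum zmodp matrix.
From mathcomp Require Import boolp classical_sets functions reals interval_inference topology normedtype landau derive.
Set Implicit Arguments.
Unset Strict Implicit.
Unset Printing Implicit Defensive.
Import Order.TTheory GRing.Theory Num.Theory numFieldNormedType.Exports.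
Local Open Scope classical_set_scope.
Local Open Scope ring_scope.

Section Smooth.
Context {R : realType}.

(* The source is meant to be finite-dimensional: there, C^k regularity of f on
   an open set is C^(k-1) regularity of all its directional derivatives. *)
Fixpoint kdiff {V W : normedModType R} (k : nat) (f : V -> W) (x : V) : Prop :=
  match k with
  | 0 => {for x, continuous f}
  | k'.+1 => differentiable f x /\
      forall v : V, kdiff k' (fun y => 'd f y v) x
  end.

(* C^oo on U, for U open *)
Definition smooth {V W : normedModType R} (U : set V) (f : V -> W) : Prop :=
  forall k x, U x -> kdiff k f x.

Lemma near_diff {V W : normedModType R} (f g : V -> W) (x : V) :
  (\forall y \near x, f y = g y) -> differentiable f x ->
  differentiable g x /\ ('d f x = 'd g x :> (V -> W)).
Proof.
move=> fg df.
have fgx : f x = g x by apply: nbhs_singleton fg.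
have cd := diff_continuous df.
have E : g \o shift x = cst (g x) + 'd f x +o_ 0 id.
  apply/eqaddoP => _/posnumP[e].
  have /eqaddoP/(_ e%:num) := diff_locally df.
  move=> /(_ (gt0 e)) H.
  have fg0 : \forall y \near (0 : V), f (y + x) = g (y + x).
    by have := fg; rewrite (near_shift 0 x) /= subr0; apply: filterS => y.
  near=> y.
  have -> : (g \o shift x - (cst (g x) + 'd f x)) y =
            (f \o shift x - (cst (f x) + 'd f x)) y.
    rewrite /= !fctE /= fgx; congr (_ - _).
    by apply/esym; near: y.
  by near: y.
have ug := diff_unique cd E.
split; last exact/esym.
apply/diff_locallyP; split; first by rewrite ug.
by rewrite ug.
Unshelve. all: by end_near. Qed.

Lemma eq_kdiff {V W : normedModType R} k (U : set V) (f g : V -> W) :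
  open U -> {in U, f =1 g} ->
  (forall x, U x -> kdiff k f x) -> forall x, U x -> kdiff k g x.
Proof.
move=> oU; elim: k f g => [|k IH] f g fg Hf x Ux.
  have fgx : \forall y \near x, f y = g y.
    by apply: filterS (open_nbhs_nbhs (conj oU Ux)) => y Uy; apply: fg; rewrite inE.
  rewrite /= /prop_for /continuous_at -(nbhs_singleton fgx).
  exact: cvg_trans (near_eq_cvg fgx) (Hf _ Ux).
have H y : U y -> differentiable g y /\ ('d f y = 'd g y :> (V -> W)).
  move=> Uy; apply: near_diff; last by have [] := Hf y Uy.
  by apply: filterS (open_nbhs_nbhs (conj oU Uy)) => z Uz; apply: fg; rewrite inE.
split; first by have [] := H x Ux.
move=> v; apply: (IH (fun y => 'd f y v)) => [||//].
  by move=> y /set_mem Uy; have [_ ->] := H y Uy.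
by move=> y Uy; have [_ ] := Hf y Uy; apply.
Qed.

Lemma kdiffS {V W : normedModType R} k (f : V -> W) (x : V) :
  kdiff k.+1 f x -> kdiff k f x.
Proof.
elim: k f x => [|k IH] f x [df Hf] /=; first exact: differentiable_continuous.
by split=> // v; apply: IH.
Qed.

Lemma kdiff_cst {V W : normedModType R} k (c : W) (x : V) : kdiff k (cst c) x.
Proof.
elim: k c x => [|k IH] c x /=; first exact: cst_continuous.
split; first exact: differentiable_cst.
move=> v; have -> : (fun y : V => 'd (cst c) y v) = cst 0 :> (V -> W).
  by apply/funext => y; rewrite diff_cst.
exact: IH.
Qed.

Lemma kdiffD {V W : normedModType R} k (U : set V) (f g : V -> W) : open U ->
  (forall x, U x -> kdiff k f x) -> (forall x, U x -> kdiff k g x) ->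
  forall x, U x -> kdiff k (f + g) x.
Proof.
move=> oU; elim: k f g => [|k IH] f g Hf Hg x Ux.
  by apply: cvgD; [exact: Hf|exact: Hg].
have [df _] := Hf x Ux; have [dg _] := Hg x Ux.
split; first exact: differentiableD.
move=> v; apply: (eq_kdiff (f := (fun y => 'd f y v) + (fun y => 'd g y v)) oU _ _ Ux).
  move=> y /set_mem Uy; rewrite diffD //; [by have [] := Hf y Uy|by have [] := Hg y Uy].
apply: IH => y Uy; [by have [_] := Hf y Uy; apply|by have [_] := Hg y Uy; apply].
Qed.

Lemma kdiffZl {V W : normedModType R} k (U : set V) (f : V -> R) (w : W) :
  open U -> (forall x, U x -> kdiff k f x) ->
  forall x, U x -> kdiff k (fun y => f y *: w) x.
Proof.
move=> oU; elim: k f => [|k IH] f Hf x Ux.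
  by apply: cvgZr_tmp; exact: Hf.
have [df _] := Hf x Ux.
split; first exact: differentiableZl.
move=> v; apply: (eq_kdiff (f := fun y => 'd f y v *: w) oU _ _ Ux).
  by move=> y /set_mem Uy; rewrite diffZl //; have [] := Hf y Uy.
by apply: IH => y Uy; have [_] := Hf y Uy; apply.
Qed.

Lemma kdiffM {V : normedModType R} k (U : set V) (f g : V -> R) : open U ->
  (forall x, U x -> kdiff k f x) -> (forall x, U x -> kdiff k g x) ->
  forall x, U x -> kdiff k (f * g) x.
Proof.
move=> oU; elim: k f g => [|k IH] f g Hf Hg x Ux.
  by apply: cvgM; [exact: Hf|exact: Hg].
have [df _] := Hf x Ux; have [dg _] := Hg x Ux.
split; first exact: differentiableM.
move=> v; apply: (eq_kdiff (f := f * (fun y => 'd g y v) + g * (fun y => 'd f y v)) oU _ _ Ux).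
  move=> y /set_mem Uy; rewrite diffM //; [by have [] := Hf y Uy|by have [] := Hg y Uy].
apply: kdiffD => //; apply: IH => y Uy.
- by apply: kdiffS; apply: Hf.
- by have [_] := Hg y Uy; apply.
- by apply: kdiffS; apply: Hg.
- by have [_] := Hf y Uy; apply.
Qed.

Lemma kdiff_sum {V W : normedModType R} k (U : set V) n (f : 'I_n -> V -> W) :
  open U -> (forall i x, U x -> kdiff k (f i) x) ->
  forall x, U x -> kdiff k (fun y => \sum_i f i y) x.
Proof.
move=> oU H; have -> : (fun y => \sum_i f i y) = \sum_i f i.
  by apply/funext => y; rewrite fct_sumE.
elim/big_ind: _ => [||i _]; last exact: H.
  by move=> x _; exact: kdiff_cst.
by move=> g h; apply: kdiffD.
Qed.

Lemma diff_coord {V : normedModType R} n (f : V -> 'rV[R]_n) (x v : V) a :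
  differentiable f x -> 'd (fun y => f y 0 a) x v = 'd f x v 0 a.
Proof.
move=> df; pose c (N : 'rV[R]_n) : R := N 0 a.
have cl : linear c by move=> r N N'; rewrite /c !mxE.
pose cL : {linear 'rV[R]_n -> R} := HB.pack c (GRing.isLinear.Build _ _ _ _ c cl).
have cc : continuous cL by move=> N; exact: coord_continuous.
have dc : differentiable cL (f x) by exact: linear_differentiable.
have E : 'd (cL \o f) x = 'd cL (f x) \o 'd f x :> (_ -> _) by exact: diff_comp.
have E2 : 'd cL (f x) = cL :> (_ -> _) by exact: diff_lin.
have := congr1 (@^~ v) E; rewrite E2; exact.
Qed.

Lemma kdiff_coord {V : normedModType R} k (U : set V) n (f : V -> 'rV[R]_n) :
  open U ->
  (forall x, U x -> kdiff k f x) <->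
  (forall a x, U x -> kdiff k (fun y => f y 0 a) x).
Proof.
move=> oU; split; last first.
  move=> H; have -> : f = fun y => \sum_a f y 0 a *: delta_mx 0 a.
    by apply/funext => y; rewrite -row_sum_delta.
  apply: (kdiff_sum (f := fun a y => f y 0 a *: delta_mx 0 a)) => // a.
  by apply: kdiffZl => //; exact: H.
move=> + a; elim: k f => [|k IH] f Hf x Ux.
  apply: (@continuous_comp _ _ _ f (fun N : 'rV[R]_n => N 0 a) x (Hf x Ux)).
  exact: coord_continuous.
have [df _] := Hf x Ux.
split.
  apply: (@differentiable_comp _ _ _ _ f (fun N : 'rV[R]_n => N 0 a) x df).
  exact: differentiable_coord.
move=> v; apply: (eq_kdiff (f := fun y => 'd f y v 0 a) oU _ _ Ux).
  move=> y /set_mem Uy; have [dfy _] := Hf y Uy.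
  by rewrite diff_coord.
by apply: (IH (fun y => 'd f y v)) => // y Uy; have [_] := Hf y Uy; apply.
Qed.

Lemma linear_delta {W : lmodType R} n (L : {linear 'rV[R]_n -> W}) (w : 'rV[R]_n) :
  L w = \sum_a w 0 a *: L (delta_mx 0 a).
Proof.
rewrite {1}(row_sum_delta w) linear_sum.
by apply: eq_bigr => a _; rewrite linearZ.
Qed.

Lemma kdiff_comp {V : normedModType R} k (U : set V) n (U' : set 'rV[R]_n)
    (f : V -> 'rV[R]_n) (g : 'rV[R]_n -> R) : open U ->
  (forall x, U x -> U' (f x)) ->
  (forall x, U x -> kdiff k f x) -> (forall x, U' x -> kdiff k g x) ->
  forall x, U x -> kdiff k (g \o f) x.
Proof.
move=> oU UU'; elim: k g => [|k IH] g Hf Hg x Ux.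
  by apply: continuous_comp; [exact: Hf|exact/Hg/UU'].
have df y : U y -> differentiable f y by move=> Uy; have [] := Hf y Uy.
have dg y : U' y -> differentiable g y by move=> Uy; have [] := Hg y Uy.
split; first by apply: differentiable_comp; [exact: df|exact/dg/UU'].
move=> v.
apply: (eq_kdiff (f := fun y => \sum_a
   ((fun y => 'd f y v 0 a) * ((fun z => 'd g z (delta_mx 0 a)) \o f)) y) oU _ _ Ux).
  move=> y /set_mem Uy.
  have -> : 'd (g \o f) y v = 'd g (f y) ('d f y v).
    exact: (congr1 (@^~ v) (diff_comp (df y Uy) (dg _ (UU' _ Uy)))).
  exact/esym/(linear_delta ('d g (f y))).
apply: kdiff_sum => // a; apply: kdiffM => //.
  by apply: (kdiff_coord _ _ oU).1 => y Uy; have [_] := Hf y Uy; apply.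
apply: IH => y Uy; first by apply/kdiffS/Hf.
by have [_] := Hg y Uy; apply.
Qed.

Lemma eq_smooth {V W : normedModType R} (U : set V) (f g : V -> W) :
  open U -> {in U, f =1 g} -> smooth U f -> smooth U g.
Proof. by move=> oU fg H k; apply: eq_kdiff oU fg (H k). Qed.

Lemma sub_smooth {V W : normedModType R} (U U' : set V) (f : V -> W) :
  U `<=` U' -> smooth U' f -> smooth U f.
Proof. by move=> UU' H k x /UU'; exact: H. Qed.

Lemma smooth_coord {V : normedModType R} (U : set V) n (f : V -> 'rV[R]_n) :
  open U -> smooth U f <-> forall a, smooth U (fun y => f y 0 a).
Proof.
move=> oU; split=> [H a k|H k]; first by apply: (kdiff_coord _ _ oU).1 => x; exact: H.
by apply: (kdiff_coord _ _ oU).2 => a x; exact: H.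
Qed.

Lemma smooth_comp {V : normedModType R} (U : set V) n (U' : set 'rV[R]_n) m
    (f : V -> 'rV[R]_n) (g : 'rV[R]_n -> 'rV[R]_m) : open U -> open U' ->
  (forall x, U x -> U' (f x)) -> smooth U f -> smooth U' g -> smooth U (g \o f).
Proof.
move=> oU oU' UU' Hf Hg; apply/smooth_coord => // a k.
have Hga := (smooth_coord _ oU').1 Hg a.
apply: (kdiff_comp (g := fun y => g y 0 a) oU UU'); [exact: Hf|exact: Hga].
Qed.

Lemma smooth_sumZ {V : normedModType R} (U : set V) n (f : 'I_n -> V -> R)
    m (g : 'I_n -> V -> 'rV[R]_m) : open U ->
  (forall a, smooth U (f a)) -> (forall a, smooth U (g a)) ->
  smooth U (fun y => \sum_a f a y *: g a y).
Proof.
move=> oU Hf Hg; apply/smooth_coord => // b k.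
have -> : (fun y => (\sum_a f a y *: g a y) 0 b) =
          (fun y => \sum_a (f a * (fun y => g a y 0 b)) y).
  by apply/funext => y; rewrite summxE; apply: eq_bigr => a _; rewrite mxE.
apply: kdiff_sum => // a; apply: kdiffM => // x; first exact: Hf.
exact: ((smooth_coord _ oU).1 (Hg a)).
Qed.

Lemma diff_comp_near {V1 V2 V3 : normedModType R} (f : V1 -> V2) (g : V2 -> V3)
    (h : V1 -> V3) x y v : f x = y ->
  differentiable f x -> differentiable g y ->
  (\forall z \near x, g (f z) = h z) -> 'd g y ('d f x v) = 'd h x v.
Proof.
move=> <- df dg gfh.
have [_ E] := near_diff (f := g \o f) gfh (differentiable_comp df dg).
have E2 := congr1 (@^~ v) (diff_comp df dg).
exact: etrans (esym E2) (congr1 (@^~ v) E).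
Qed.
End Smooth.

Record manifold (R : realType) := Manifold {
  mcarrier :> topologicalType;
  mhausdorff : hausdorff_space mcarrier;
  msecond_countable : @second_countable mcarrier;
  mdim : nat;
  chart : Type;
  (* cmap i and cinv i are total functions, relevant only on cdom i and on its
     image, where they are mutually inverse *)
  cdom : chart -> set mcarrier;
  cmap : chart -> mcarrier -> 'rV[R]_mdim;
  cinv : chart -> 'rV[R]_mdim -> mcarrier;
  cdom_open : forall i, open (cdom i);
  cimg_open : forall i, open (cmap i @` cdom i);
  cmapK : forall i x, cdom i x -> cinv i (cmap i x) = x;
  cmap_continuous : forall i x, cdom i x -> {for x, continuous (cmap i)};
  cinv_continuous : forall i x, cdom i x ->
    {for cmap i x, continuous (cinv i)};
  cdom_cover : forall x, exists i, cdom i x;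
  ctrans_smooth : forall i j,
    smooth (cmap i @` (cdom i `&` cdom j)) (cmap j \o cinv i)
}.

Section Manifold.
Context {R : realType} (M : manifold R).

Lemma chart_open (i : chart M) (A : set M) :
  open A -> open (cmap i @` (cdom i `&` A)).
Proof.
move=> oA; rewrite openE => _ [x [ix Ax] <-]; rewrite /interior.
have cix : \forall y \near cmap i x, A (cinv i y).
  apply: (cinv_continuous ix).
  by rewrite cmapK //; exact: open_nbhs_nbhs.
have uix : \forall y \near cmap i x, (cmap i @` cdom i) y.
  by apply: open_nbhs_nbhs; split; [exact: cimg_open|exists x].
near=> y.
have [z iz zy] : (cmap i @` cdom i) y by near: y.
exists z => //; split=> //; rewrite -(cmapK iz) zy; near: y; exact: cix.
Unshelve. all: by end_near. Qed.

(* f is C^oo on the open set A of M *)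
Definition msmooth {W : normedModType R} (A : set M) (f : M -> W) : Prop :=
  forall i : chart M, smooth (cmap i @` (cdom i `&` A)) (f \o cinv i).

Definition chart_at (x : M) : chart M := projT1 (cid (cdom_cover x)).

Lemma mem_chart_at x : cdom (chart_at x) x.
Proof. by rewrite /chart_at; case: cid. Qed.

Lemma eq_msmooth {W : normedModType R} (A : set M) (f g : M -> W) : open A ->
  {in A, f =1 g} -> msmooth A f -> msmooth A g.
Proof.
move=> oA fg Hf i; apply: eq_smooth (Hf i); first exact: chart_open.
by move=> _ /set_mem[x [ix Ax] <-] /=; rewrite cmapK // fg // inE.
Qed.

Lemma sub_msmooth {W : normedModType R} (A B : set M) (f : M -> W) :
  A `<=` B -> msmooth B f -> msmooth A f.
Proof.
move=> AB H i; apply: sub_smooth (H i).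
by move=> _ [x [ix Ax] <-]; exists x => //; split=> //; exact: AB.
Qed.

Lemma msmooth_local {W : normedModType R} (A : set M) (f : M -> W) :
  (forall x, A x -> exists2 B, B x & msmooth (A `&` B) f) -> msmooth A f.
Proof.
move=> H i k _ [x [ix Ax] <-]; have [B Bx /(_ i k)] := H x Ax.
by apply; exists x.
Qed.

Lemma msmooth_coord (A : set M) n (f : M -> 'rV[R]_n) :
  open A -> msmooth A f <-> forall a, msmooth A (fun x => f x 0 a).
Proof.
move=> oA; split=> [H a i|H i].
  exact: ((smooth_coord (f \o cinv i) (chart_open (i := i) oA)).1 (H i) a).
by apply: (smooth_coord (f \o cinv i) (chart_open (i := i) oA)).2 => a; exact: H.
Qed.

Lemma msmooth_sumZ (A : set M) n (f : 'I_n -> M -> R) m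
    (g : 'I_n -> M -> 'rV[R]_m) : open A ->
  (forall a, msmooth A (f a)) -> (forall a, msmooth A (g a)) ->
  msmooth A (fun y => \sum_a f a y *: g a y).
Proof.
move=> oA Hf Hg i.
apply: (smooth_sumZ (f := fun a => f a \o cinv i) (g := fun a => g a \o cinv i)).
- exact: chart_open.
- by move=> a; exact: Hf.
- by move=> a; exact: Hg.
Qed.

Lemma msmooth0 {W : normedModType R} (A : set M) : msmooth A (fun=> 0 : W).
Proof. by move=> i k x _; exact: kdiff_cst. Qed.

Lemma msmoothD {W : normedModType R} (A : set M) (f g : M -> W) : open A ->
  msmooth A f -> msmooth A g -> msmooth A (fun x => f x + g x).
Proof.
move=> oA Hf Hg i k; apply: (kdiffD (f := f \o cinv i) (g := g \o cinv i)).
- exact: chart_open.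
- exact: Hf.
- exact: Hg.
Qed.

Lemma msmoothZ (A : set M) n (c : R) (f : M -> 'rV[R]_n) : open A ->
  msmooth A f -> msmooth A (fun x => c *: f x).
Proof.
move=> oA Hf.
apply: (@eq_msmooth _ _ (fun x => \sum_(a < 1) (fun=> c) x *: f x)) => //.
  by move=> x _; rewrite big_ord1.
by apply: msmooth_sumZ => // _ i k x _; exact: kdiff_cst.
Qed.

End Manifold.
Arguments mdim {R} m.
Arguments chart {R} m.

Record vbundle (R : realType) (M : manifold R) := VBundle {
  vrank : nat;
  fib : M -> lmodType R;
  triv_ix : Type;
  vdom : triv_ix -> set M;
  (* triv i x and trivI i x are only relevant for x in vdom i *)
  triv : forall (i : triv_ix) (x : M), {linear fib x -> 'rV[R]_vrank};
  trivI : forall (i : triv_ix) (x : M), 'rV[R]_vrank -> fib x;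
  vdom_open : forall i, open (vdom i);
  vdom_cover : forall x, exists i, vdom i x;
  trivK : forall i x, vdom i x -> cancel (triv i x) (trivI i x);
  trivIK : forall i x, vdom i x -> cancel (trivI i x) (triv i x);
  vtrans_smooth : forall i j (v : 'rV[R]_vrank),
    msmooth (vdom i `&` vdom j) (fun x => triv j x (trivI i x v))
}.

Section Bundles.
Context {R : realType} {M : manifold R}.

(* s is a smooth section of F over the open set A *)
Definition smooth_section_on (F : vbundle M) (A : set M)
    (s : forall x, fib F x) : Prop :=
  forall i : triv_ix F, msmooth (A `&` vdom i) (fun x => triv i x (s x)).

Record section (F : vbundle M) := MkSection {
  section_val :> forall x : M, fib F x;
  section_smooth : smooth_section_on setT section_val
}.

Record bundle_morphism (F G : vbundle M) := BundleMorphism {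
  bmap :> forall x : M, {linear fib F x -> fib G x};
  bmap_smooth : forall (i : triv_ix F) (v : 'rV[R]_(vrank F)),
    smooth_section_on (vdom i) (fun x => bmap x (trivI i x v))
}.

Lemma bmap_section (F G : vbundle M) (f : bundle_morphism F G) A s :
  open A -> smooth_section_on A s ->
  smooth_section_on A (fun x => f x (s x)).
Proof.
move=> oA Hs k; apply: msmooth_local => x [Ax kx].
have [j jx] := vdom_cover F x; exists (vdom j) => //.
have oAkj : open (A `&` vdom k `&` vdom j).
  by apply: openI; [apply: openI|]; rewrite //; exact: vdom_open.
apply: (@eq_msmooth _ _ _ _ (fun y => \sum_a
   (triv j y (s y)) 0 a *: triv k y (f y (trivI j y (delta_mx 0 a))))) => //.
  move=> y /set_mem[[Ay ky] jy].
  rewrite -[in RHS](trivK jy (s y)).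
  pose g := triv k y \o f y.
  have trivIE w : trivI j y w = \sum_a w 0 a *: trivI j y (delta_mx 0 a).
    apply: (can_inj (trivK jy)); rewrite trivIK // linear_sum /=.
    rewrite [LHS]row_sum_delta; apply: eq_bigr => a _.
    by rewrite linearZ /= trivIK.
  rewrite (trivIE (triv j y (s y))) !linear_sum /=.
  by apply: eq_bigr => a _; rewrite !linearZ.
apply: msmooth_sumZ => // a.
  apply: (msmooth_coord _ oAkj).1.
  by apply: sub_msmooth (Hs j) => y [[]].
apply: sub_msmooth (@bmap_smooth _ _ f j (delta_mx 0 a) k).
by move=> y [[]].
Qed.

Definition bmap_comp (F G H : vbundle M) (g : bundle_morphism G H)
  (f : bundle_morphism F G) : bundle_morphism F H :=
  {| bmap := fun x => g x \o f x;
     bmap_smooth := fun i v =>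
       bmap_section g (vdom_open i) (@bmap_smooth _ _ f i v) |}.

Definition bmap_apply (F G : vbundle M) (f : bundle_morphism F G)
    (X : section F) : section G :=
  {| section_val := fun x => f x (X x);
     section_smooth := bmap_section f openT (section_smooth X) |}.

End Bundles.

Section Tangent.
Context {R : realType} (M : manifold R).
Implicit Types (i j k : chart M) (x : M).

(* Jacobian at x of the change of coordinates from chart i to chart j *)
Definition tjac i j x : {linear 'rV[R]_(mdim M) -> 'rV[R]_(mdim M)} :=
  'd (cmap j \o cinv i) (cmap i x).

Lemma ctrans_differentiable i j x : cdom i x -> cdom j x ->
  differentiable (cmap j \o cinv i) (cmap i x).
Proof.
move=> ix jx; suff [] : kdiff 1 (cmap j \o cinv i) (cmap i x) by [].
by apply: ctrans_smooth; exists x.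
Qed.

Lemma tjac_comp i j k x v : cdom i x -> cdom j x -> cdom k x ->
  tjac j k x (tjac i j x v) = tjac i k x v.
Proof.
move=> ix jx kx.
apply: (diff_comp_near (f := cmap j \o cinv i) (g := cmap k \o cinv j)).
- by rewrite /comp cmapK.
- exact: ctrans_differentiable.
- exact: ctrans_differentiable.
have : nbhs (cmap i x) (cmap i @` (cdom i `&` cdom j)).
  apply: open_nbhs_nbhs; split; last by exists x.
  by apply: chart_open; exact: cdom_open.
by apply: filterS => _ [y [iy jy] <-]; rewrite /comp (cmapK iy) (cmapK jy).
Qed.

Lemma tjac_id i x v : cdom i x -> tjac i i x v = v.
Proof.
move=> ix.
have Ei : \forall y \near cmap i x, id y = (cmap i \o cinv i) y.
  have : nbhs (cmap i x) (cmap i @` cdom i).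
    by apply: open_nbhs_nbhs; split; [exact: cimg_open|exists x].
  by apply: filterS => _ [y iy <-] /=; rewrite cmapK.
have did : differentiable (@id 'rV[R]_(mdim M)) (cmap i x) by exact: ex_diff.
have [_ E] := near_diff Ei did.
have E2 : 'd id (cmap i x) = id :> ('rV[R]_(mdim M) -> 'rV[R]_(mdim M)).
  exact: diff_val.
exact: (etrans (congr1 (@^~ v) (esym E)) (congr1 (@^~ v) E2)).
Qed.

Lemma tjac_smooth i j (v : 'rV[R]_(mdim M)) :
  msmooth (cdom i `&` cdom j)
    (fun x => tjac (chart_at x) j x (tjac i (chart_at x) x v)).
Proof.
have oij : open (cdom i `&` cdom j) by apply: openI; exact: cdom_open.
apply: (@eq_msmooth _ _ _ _ (fun x => tjac i j x v)) => //.
  move=> x /set_mem[ix jx]; exact/esym/(tjac_comp v ix (mem_chart_at x) jx).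
move=> k.
apply: (smooth_comp (U' := cmap i @` (cdom i `&` cdom j))
  (f := cmap i \o cinv k) (g := fun y => 'd (cmap j \o cinv i) y v)).
- exact: chart_open.
- by apply: chart_open; exact: cdom_open.
- by move=> _ [x [kx [ix jx]] <-] /=; rewrite cmapK //; exists x.
- apply: sub_smooth (@ctrans_smooth _ M k i).
  by move=> _ [x [kx [ix jx]] <-]; exists x.
- move=> n y Uy; by have [_] := @ctrans_smooth _ M i j n.+1 y Uy; apply.
Qed.

(* T_x M is R^n, in the coordinates of the distinguished chart around x; the
   local trivializations are the coordinates in the other charts. *)
Definition tangent_bundle : vbundle M :=
  {| vrank := mdim M;
     fib := fun=> 'rV[R]_(mdim M);
     vdom := @cdom R M;
     triv := fun i x => tjac (chart_at x) i x;
     trivI := fun i x => tjac i (chart_at x) x;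
     vdom_open := @cdom_open R M;
     vdom_cover := @cdom_cover R M;
     trivK := fun i x ix v => etrans
       (tjac_comp v (mem_chart_at x) ix (mem_chart_at x))
       (tjac_id v (mem_chart_at x));
     trivIK := fun i x ix v => etrans
       (tjac_comp v ix (mem_chart_at x) ix) (tjac_id v ix);
     vtrans_smooth := tjac_smooth |}.

(* v . f, for v in T_x M *)
Definition tderive (x : M) (v : fib tangent_bundle x) (f : M -> R) : R :=
  'd (f \o cinv (chart_at x)) (cmap (chart_at x) x) v.

End Tangent.

Section SectionModule.
Context {R : realType} {M : manifold R} (F : vbundle M).
Implicit Types X Y Z : section F.

Lemma sectionP X Y : (forall x, X x = Y x) -> X = Y.
Proof.
case: X Y => [X sX] [Y sY] /= XY.
have {}XY : X = Y by apply: functional_extensionality_dep.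
by subst Y; congr MkSection; exact: Prop_irrelevance.
Qed.

Lemma section0_subproof : smooth_section_on setT (fun x => 0 : fib F x).
Proof.
move=> i; apply: (@eq_msmooth _ _ _ _ (fun=> 0)).
- by rewrite setTI; exact: vdom_open.
- by move=> x _; rewrite linear0.
- exact: msmooth0.
Qed.

Lemma sectionL_subproof c X Y :
  smooth_section_on setT (fun x => c *: X x + Y x).
Proof.
move=> i.
have oi : open (setT `&` vdom i) by rewrite setTI; exact: vdom_open.
apply: (@eq_msmooth _ _ _ _
  (fun x => c *: triv i x (X x) + triv i x (Y x))) => //.
  by move=> x _; rewrite linearP.
by apply: msmoothD => //; [apply: msmoothZ|]; rewrite //; exact: section_smooth.
Qed.

Definition section0 : section F := MkSection section0_subproof.
Definition sectionL c X Y : section F := MkSection (sectionL_subproof c X Y).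
Definition sectionD X Y : section F := sectionL 1 X Y.
Definition sectionN X : section F := sectionL (-1) X section0.
Definition sectionZ c X : section F := sectionL c X section0.

Lemma sectionDA : associative sectionD.
Proof. by move=> X Y Z; apply: sectionP => x /=; rewrite !scale1r addrA. Qed.

Lemma sectionDC : commutative sectionD.
Proof. by move=> X Y; apply: sectionP => x /=; rewrite !scale1r addrC. Qed.

Lemma section0D : left_id section0 sectionD.
Proof. by move=> X; apply: sectionP => x /=; rewrite scale1r add0r. Qed.

Lemma sectionND : left_inverse section0 sectionN sectionD.
Proof.
by move=> X; apply: sectionP => x /=; rewrite scale1r addr0 scaleN1r addNr.
Qed.

HB.instance Definition _ := gen_eqMixin (section F).
HB.instance Definition _ := gen_choiceMixin (section F).
HB.instance Definition _ := GRing.isZmodule.Build (section F)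
  sectionDA sectionDC section0D sectionND.

Lemma section_addE X Y x : (X + Y) x = X x + Y x.
Proof. by rewrite /= scale1r. Qed.

Lemma sectionZA a b X : sectionZ a (sectionZ b X) = sectionZ (a * b) X.
Proof. by apply: sectionP => x /=; rewrite !addr0 scalerA. Qed.

Lemma section1Z : left_id 1 sectionZ.
Proof. by move=> X; apply: sectionP => x /=; rewrite scale1r addr0. Qed.

Lemma sectionZDr : right_distributive sectionZ +%R.
Proof.
by move=> a X Y; apply: sectionP => x; rewrite /= !addr0 !scale1r scalerDr.
Qed.

Lemma sectionZDl X : {morph sectionZ^~ X : a b / a + b}.
Proof.
by move=> a b; apply: sectionP => x; rewrite /= !addr0 !scale1r scalerDl.
Qed.

HB.instance Definition _ := GRing.Zmodule_isLmodule.Build R (section F)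
  sectionZA section1Z sectionZDr sectionZDl.

Lemma section_oppE X x : (- X) x = - X x.
Proof. by rewrite /= addr0 scaleN1r. Qed.

Lemma section_scaleE a X x : (a *: X) x = a *: X x.
Proof. by rewrite /= addr0. Qed.

End SectionModule.

Section PreCourant.
Context {R : realType} {M : manifold R} {E : vbundle M}.

Record bundle_metric := BundleMetric {
  form : forall x : M, fib E x -> fib E x -> R;
  form_linearl : forall x v, scalar ((@form x)^~ v);
  form_linearr : forall x u, scalar (@form x u);
  form_sym : forall x (u v : fib E x), form u v = form v u;
  form_nondegenerate : forall x (u : fib E x), (forall v, form u v = 0) -> u = 0;
  form_smooth : forall (i : triv_ix E) (u v : 'rV[R]_(vrank E)),
    msmooth (vdom i) (fun x => form (trivI i x u) (trivI i x v))
}.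

Definition pairing (g : bundle_metric) (X Y : section E) : M -> R :=
  fun x => form g (X x) (Y x).

(* A pair (rho, [.,.]), not yet subject to any axiom. *)
Record courant_data := CourantData {
  anchor : bundle_morphism E (tangent_bundle M);
  bracket : section E -> section E -> section E
}.

(* rho(X) . f *)
Definition anchor_derive (Theta : courant_data) (X : section E) (f : M -> R) :
    M -> R :=
  fun x => tderive (anchor Theta x (X x)) f.

Record is_pre_courant (g : bundle_metric) (Theta : courant_data) : Prop := {
  bracket_linearl : forall Y, linear ((bracket Theta)^~ Y);
  bracket_linearr : forall X, linear (bracket Theta X);
  anchor_metric : forall X Y Z,
    anchor_derive Theta X (pairing g Y Z) =
    pairing g (bracket Theta X Y) Z + pairing g Y (bracket Theta X Z);
  anchor_sym : forall X Y Z,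
    anchor_derive Theta X (pairing g Y Z) =
    pairing g X (bracket Theta Y Z + bracket Theta Z Y)
}.

Definition deform (Theta : courant_data) (I : bundle_morphism E E) :
    courant_data :=
  {| anchor := bmap_comp (anchor Theta) I;
     bracket := fun X Y =>
       bracket Theta (bmap_apply I X) Y + bracket Theta X (bmap_apply I Y)
       - bmap_apply I (bracket Theta X Y) |}.

Definition torsion (Theta : courant_data) (J : bundle_morphism E E)
    (X Y : section E) : section E :=
  bracket Theta (bmap_apply J X) (bmap_apply J Y)
  - bmap_apply J (bracket (deform Theta J) X Y).

End PreCourant.
Arguments bundle_metric {R M} E.
Arguments courant_data {R M} E.

(* Main.v *)
(* Since Theta_I is built from Theta by precomposing either argument, or
   postcomposing the value, with I, and the torsion is linear in the bracket,
   T_{Theta_I} I (X, Y) = T (I X, Y) + T (X, I Y) - I (T (X, Y)) for T = T_Theta I.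
   As I^2 = lambda id, both T (I X, Y) and T (X, I Y) equal - I (T (X, Y)).  Hence
   T_{Theta_I} I = -3 I o T, and I is invertible since lambda <> 0. *)
Require Import Defs.
From HB Require Import structures.
From mathcomp Require Import all_boot order ssralg ssrnum zmodp matrix.
From mathcomp Require Import boolp classical_sets functions reals interval_inference topology normedtype landau derive.
Set Implicit Arguments.
Unset Strict Implicit.
Unset Printing Implicit Defensive.
Import Order.TTheory GRing.Theory Num.Theory numFieldNormedType.Exports.
Local Open Scope classical_set_scope.
Local Open Scope ring_scope.

Section TorsionOfDeformation.
Context {R : realType} {M : manifold R} {E : vbundle M}.
Implicit Types (X Y : section E) (I : bundle_morphism E E).

Lemma bmap_apply_linear (F G : vbundle M) (f : bundle_morphism F G) :
  linear (bmap_apply f).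
Proof.
move=> a X Y; apply: sectionP => x.
by rewrite section_addE section_scaleE /= addr0 scale1r linearP.
Qed.

HB.instance Definition _ (F G : vbundle M) (f : bundle_morphism F G) :=
  GRing.isLinear.Build R (section F) (section G) *:%R (bmap_apply f)
    (bmap_apply_linear f).

Lemma bmap_apply_sqr I (lambda : R) :
  (forall x e, I x (I x e) = lambda *: e) ->
  forall X, bmap_apply I (bmap_apply I X) = lambda *: X.
Proof. by move=> hI X; apply: sectionP => x; rewrite section_scaleE /= hI. Qed.

(** Both sides expand to the same six terms, with [B] the once-deformed bracket: the
    $[\mathcal{I}\cdot,\mathcal{I}\cdot]$ parts of the three torsions on the right assemble into
    $B(\mathcal{I}X,\mathcal{I}Y)$, and their [B] parts into $\mathcal{I}$ of the twice-deformed
    bracket. *)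
Lemma torsion_deform (Theta : courant_data E) I X Y :
  torsion (deform Theta I) I X Y =
  torsion Theta I (bmap_apply I X) Y + torsion Theta I X (bmap_apply I Y)
  - bmap_apply I (torsion Theta I X Y).
Proof.
(* Used to exchange $\mathcal{I}[\mathcal{I}X,\mathcal{I}Y]$ with
   $\mathcal{I}(B(\mathcal{I}X,Y)+B(X,\mathcal{I}Y))$, which completes
   $B(\mathcal{I}X,\mathcal{I}Y)$. *)
have H (V : zmodType) (a b c d : V) : a - b - (c - d) = a - c - (b - d).
  by rewrite !opprB addrACA [RHS]addrACA (addrC (- b)).
pose B := bracket (deform Theta I).
have T_B U V : torsion Theta I U V =
    bracket Theta (bmap_apply I U) (bmap_apply I V) - bmap_apply I (B U V) by [].
rewrite !{}T_B addrACA -opprD -raddfD [in RHS]raddfB -H -raddfB.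
by [].
Qed.

(** As [lambda] is a constant, it leaves the bracket by $\mathbb{R}$-linearity, with no derivative
    term. Both sides become
    $\lambda[\mathcal{I}X,Y]+\lambda[X,\mathcal{I}Y]-\lambda\mathcal{I}[X,Y]-\mathcal{I}[\mathcal{I}X,\mathcal{I}Y]$. *)
Lemma torsion_bmapl (Theta : courant_data E) I (lambda : R) X Y :
  (forall Z, linear ((bracket Theta)^~ Z)) ->
  (forall x (e : fib E x), I x (I x e) = lambda *: e) ->
  torsion Theta I (bmap_apply I X) Y = - bmap_apply I (torsion Theta I X Y).
Proof.
move=> linl /bmap_apply_sqr II; have BZl Z := scalable_linear (linl Z) lambda X.
rewrite /= in BZl; rewrite /torsion /= !(II, BZl) !(raddfB, raddfD) /= !II linearZ /=.
rewrite !opprK addrCA (addrC (- (_ *: _))) -addrA.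
by rewrite (addrC (- (_ *: _))) (addrC (_ *: bracket _ X _)).
Qed.

Lemma torsion_bmapr (Theta : courant_data E) I (lambda : R) X Y :
  (forall Z, linear (bracket Theta Z)) ->
  (forall x (e : fib E x), I x (I x e) = lambda *: e) ->
  torsion Theta I X (bmap_apply I Y) = - bmap_apply I (torsion Theta I X Y).
Proof.
move=> linr /bmap_apply_sqr II; have BZr Z := scalable_linear (linr Z) lambda Y.
rewrite /= in BZr; rewrite /torsion /= !(II, BZr) !(raddfB, raddfD) /= !II linearZ /=.
by rewrite !opprK addrCA -addrA (addrC (- (_ *: _))).
Qed.

End TorsionOfDeformation.

Theorem proposition3p2 (R : realType) (M : manifold R) (E : vbundle M)
  (g : bundle_metric E) (Theta : courant_data E)
  (hTheta : is_pre_courant g Theta)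
  (I : bundle_morphism E E) (lambda : R) (hlambda : lambda != 0)
  (hI : forall (x : M) (e : fib E x), I x (I x e) = lambda *: e) :
  (forall X Y : section E, torsion Theta I X Y = 0) <->
  (forall X Y : section E, torsion (deform Theta I) I X Y = 0).
Proof.
have [linl linr _ _] := hTheta.
have II := bmap_apply_sqr hI.
(* The factor 3 counts one copy of $-\mathcal{I}\mathsf{T}$ from each argument slot and one from the
   outer term of [torsion_deform]. *)
have T_I X Y :
    torsion (deform Theta I) I X Y = - (bmap_apply I (torsion Theta I X Y) *+ 3).
  rewrite torsion_deform (torsion_bmapl _ _ linl hI) (torsion_bmapr _ _ linr hI).
  by rewrite -!opprD -mulr2n -mulrSr.
split=> T0 X Y; first by rewrite T_I T0 linear0 mul0rn oppr0.
have /eqP := T0 X Y.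
(* The factor 3 cancels because it is nonzero in the real field. *)
rewrite T_I oppr_eq0 -scaler_nat scaler_eq0 pnatr_eq0 /= => /eqP IT0.
(* A second application of $\mathcal{I}$ turns $\mathcal{I}\mathsf{T}=0$ into
   $\lambda\mathsf{T}=0$. *)
have := II (torsion Theta I X Y).
by rewrite IT0 linear0 => /esym/eqP; rewrite scaler_eq0 (negbTE hlambda) => /eqP.
Qed.
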